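(* Let $\lambda$ be a partition of a positive integer $n=n(\lambda)$ with $N=N(\lambda)$ parts, let $\lambda'=(\lambda'_1,\dots,\lambda'_{N'})$ be its dual partition, and let $d(\lambda)$ be the exact power of $q$ dividing the polynomial $P_\lambda(q)$ that counts strictly upper triangular $n\times n$ matrices over $\mathbb{F}_q$ of Jordan type $\lambda$. Then $$d(\lambda)=\binom{n(\lambda)}{2}-\binom{N(\lambda)}{2}-\lambda'_1\lambda'_2-\lambda'_2\lambda'_3-\dots-\lambda'_{N'-1}\lambda'_{N'}.$$
   Context: A partition of a positive integer $n$ is a sequence $\lambda=(\lambda_1,\dots,\lambda_N)$ of integers with $\lambda_1\ge\dots\ge\lambda_N>0$ and $\lambda_1+\dots+\lambda_N=n$; write $n(\lambda)=n$ and $N(\lambda)=N$ (the number of parts). The dual partition is $\lambda'=(\lambda'_1,\dots,\lambda'_{N'})$ with $\lambda'_j=\#\{i\mid\lambda_i\ge j\}$ and $N'=\lambda_1$, so $\lambda'_1=N$. A strictly upper triangular matrix has Jordan type $\lambda$ if the sizes of its (nilpotent) Jordan blocks, listed in non-increasing order, are $\lambda_1,\dots,\lambda_N$. For a prime power $q$, $P_\lambda(q)$ denotes the number of strictly upper triangular $n\times n$ matrices over the finite field $\mathbb{F}_q$ of Jordan type $\lambda$. It is known that $P_\lambda(q)$ is given by a (nonzero) polynomial in $q$ with integer coefficients, also denoted $P_\lambda$. With $Q=q-1$, write $P_\lambda(q)=q^{d(\lambda)}Q^{e(\lambda)}R_\lambda(q)$, where $R_\lambda$ is a polynomial with $R_\lambda(0)\ne0$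 and $R_\lambda(1)\ne0$; this determines the non-negative integers $d(\lambda)$, $e(\lambda)$ and the polynomial $R_\lambda$ uniquely. If $N'=1$ there are no product terms in the formula. *)

(* Defs.v *)
From HB Require Import structures.
From mathcomp Require Import all_boot all_order all_algebra.

Set Implicit Arguments.
Unset Strict Implicit.
Unset Printing Implicit Defensive.

Import Order.TTheory GRing.Theory Num.Theory.

Local Open Scope ring_scope.

Definition is_partition (lam : seq nat) : bool :=
  sorted geq lam && all (leq 1) lam.

(* n(lam), written as an ordinal-indexed sum (not [sumn]) so that it is
   syntactically the dimension of the [\mxdiag] in [jordan_mx]. *)
Definition weight (lam : seq nat) : nat := (\sum_(i < size lam) nth 0 lam i)%N.

(* [nth 0 (dual_part lam) j] is lam'_(j+1). *)
Definition dual_part (lam : seq nat) : seq nat :=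
  [seq count (leq j) lam | j <- iota 1 (head 0%N lam)].

Definition strictly_upper (F : fieldType) (n : nat) (A : 'M[F]_n) : bool :=
  [forall i : 'I_n, forall j : 'I_n, (j <= i)%N ==> (A i j == 0)].

Definition jordan_block (F : fieldType) (m : nat) : 'M[F]_m :=
  \matrix_(i, j) (j == i.+1 :> nat)%:R.

Definition jordan_mx (F : fieldType) (lam : seq nat) : 'M[F]_(weight lam) :=
  \mxdiag_(i < size lam) jordan_block F (nth 0%N lam i).

Definition has_jordan_type (F : finFieldType) (lam : seq nat)
    (A : 'M[F]_(weight lam)) : bool :=
  [exists S in unitmx, similar S A (jordan_mx F lam)].

Definition jordan_count (F : finFieldType) (lam : seq nat) : nat :=
  #|[set A : 'M[F]_(weight lam) | strictly_upper A & has_jordan_type A]|.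

Definition is_counting_poly (lam : seq nat) (P : {poly int}) : Prop :=
  forall F : finFieldType, (jordan_count F lam)%:Z = P.[#|F|%:Z].

Definition qQ_factorization (P : {poly int}) (d e : nat) (R : {poly int})
    : Prop :=
  [/\ P = 'X^d * ('X - 1) ^+ e * R, R.[0] != 0 & R.[1] != 0].

(* A nonzero polynomial has such a factorization, and [d] is the exact power
   of 'X dividing it. *)
Lemma qQ_factorization_exists (P : {poly int}) :
  P != 0 -> exists d e R, qQ_factorization P d e R.
Proof.
move=> P0; have [d [P1 /implyP/(_ P0) r0 eP]] := multiplicity_XsubC P 0.
have P10 : P1 != 0 by apply: contraNneq P0 => P10; rewrite eP P10 mul0r.
have [e [R /implyP/(_ P10) r1 eP1]] := multiplicity_XsubC P1 1.
exists d, e, R; split => //; first by rewrite eP eP1 subr0 polyC1 mulrC [R * _]mulrC mulrA.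
by apply: contraNneq r0 => r0; rewrite /root eP1 hornerM r0 mul0r.
Qed.

Lemma qQ_factorization_exact (P : {poly int}) d e R :
  qQ_factorization P d e R ->
  forall k, (exists q, P = 'X^k * q) <-> (k <= d)%N.
Proof.
case=> -> R0 _ k; split=> [[q] | le_kd]; last first.
  by exists ('X^(d - k) * (('X - 1) ^+ e * R)); rewrite -[in LHS](subnKC le_kd) exprD -!mulrA.
case: leqP => // lt_dk.
have -> : 'X^k = 'X^d * ('X * 'X^(k - d.+1)) :> {poly int}.
  by rewrite -exprS -exprD addnS -addSn subnKC.
have Xd0 : 'X^d != 0 :> {poly int} by rewrite expf_neq0 ?polyX_eq0.
rewrite -!mulrA => /(mulfI Xd0).
move=> /(congr1 (horner^~ 0)); rewrite !hornerE => /eqP.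
by rewrite mulf_eq0 (negPf R0) orbF expf_eq0 oppr_eq0 oner_eq0 andbF.
Qed.

(* Main.v *)
Require Import Defs.
From HB Require Import structures.
From mathcomp Require Import all_boot all_order all_algebra.
From mathcomp Require Import mxabelem zify.

Set Implicit Arguments.
Unset Strict Implicit.
Unset Printing Implicit Defensive.

Import Order.TTheory GRing.Theory Num.Theory.

Local Open Scope ring_scope.

(** Columns of Young diagrams and entries of dual partitions are numbered from 0.

    Build a strictly upper triangular matrix of size m + 1 from one of size m,
    B, by adding a zero column on the left and a row (0 u) on top.  For k > 0 the
    k-th power of the new matrix has one more rank than the k-th power of B exactly
    when u B^(k-1) is not in the row space of B^k, which for large k no longer
    happens.  So the sequence of rank drops rank A^k - rank A^(k+1), which for
    Jordan type lam is the dual partition lam', grows by 1 at a single index j,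
    the first with u B^j in the row space of B^(j+1): a box is added to column
    j of the Young diagram.  The vectors with u B^j in that row space form a
    space of dimension m - mu'_j, where mu is the type of B, so the number of u
    that add a box in column j is q^m / q^(mu'_j), minus
    q^m / q^(mu'_(j-1)) if j > 0.  This gives the recursion [drops_countS]:
    P_lam is the sum over the corners of lam of P_mu times this number, with mu
    obtained from lam by removing the corner.

    Let D(lam) = C(N, 2) + sum_k lam'_k lam'_(k+1).  If the exact power of q in
    P_mu is C(m, 2) - D(mu), then the corner in column j contributes a term in
    which the exact power of q is C(m + 1, 2) - D(lam) + lam'_(j+1)
    ([deficit_lower]).  The exponent C(m + 1, 2) - D(lam) is therefore reached
    by the corner in the last column, and every other corner gives a strictly
    larger one, so no cancellation can occur in the lowest degree, and the
    formula follows by induction ([drops_count_poly]).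

    The ranks of the powers determine the Jordan type ([has_jordan_typeP]).
    In the direction that is not a rank computation, the Jordan chains are
    built from their last vectors: these are chosen in the kernel of A, one
    after the other in the order of decreasing chain length l, independent of
    those already chosen and in the image of A^(l-1); the rank drops say
    precisely that there is room for this ([jordan_chain_tops]).

    Finally, an integer polynomial is determined by its values at the sizes of
    finite fields, so the counting polynomial is the one of the recursion. *)

(** * Adding a row to a strictly upper triangular matrix *)

(** The sequence c of rank drops is tested below a bound K only, to be
    decidable; K stays fixed in the induction on the size m <= K of A, whose
    powers vanish from the exponent m on. *)
Definition rank_drops (F : fieldType) (K : nat) (c : nat -> nat) (m : nat)
    (A : 'M[F]_m) : bool :=
  [forall k : 'I_K, \rank (A ^+ k) == (c k + \rank (A ^+ k.+1))%N].

(** The u for which adding the row (0 u) on top of B does not raise the rank of the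
    power k + 1.  Locked, to keep conversion from unfolding Gaussian elimination. *)
HB.lock Definition absorb_mx (F : fieldType) (m : nat) (B : 'M[F]_m) (k : nat) : 'M[F]_m :=
  kermx (B ^+ k *m cokermx (B ^+ k.+1)).

Section Extension.
Variables (F : fieldType) (m : nat).
Implicit Types (u : 'rV[F]_m) (B : 'M[F]_m).

Definition ext_mx u B : 'M[F]_(1 + m) := block_mx 0 u 0 B.

Lemma ext_mxX u B k :
  ext_mx u B ^+ k.+1 = block_mx 0 (u *m B ^+ k) 0 (B ^+ k.+1).
Proof.
elim: k => [|k IHk]; first by rewrite expr0 !expr1 mulmx1.
rewrite exprSr IHk -mulmxE /ext_mx mulmx_block !(mulmx0, mul0mx) !add0r.
by rewrite -mulmxA mulmxE -!exprSr.
Qed.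

Lemma expmxS B k : B ^+ k.+1 = B *m B ^+ k.
Proof. by rewrite exprS. Qed.

Lemma expmxSr B k : B ^+ k.+1 = B ^+ k *m B.
Proof. by rewrite exprSr. Qed.

Lemma absorb_mxP u B k :
  (u <= absorb_mx B k)%MS = (u *m B ^+ k <= B ^+ k.+1)%MS.
Proof. by rewrite absorb_mx.unlock sub_kermx submxE mulmxA. Qed.

(** Multiplying u B^k in rowspace B^(k+1) by B gives the next condition, so these
    spaces form an increasing flag. *)
Lemma absorb_mx_mono B k : (absorb_mx B k <= absorb_mx B k.+1)%MS.
Proof.
apply/row_subP=> i; set u := row i _.
have: (u <= absorb_mx B k)%MS by apply: row_sub.
rewrite !absorb_mxP => /(submxMr B).
by rewrite -mulmxA -!expmxSr.
Qed.

Lemma absorb_mx_le B i j : (i <= j)%N -> (absorb_mx B i <= absorb_mx B j)%MS.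
Proof.
move/subnKC<-; elim: (j - i)%N => [|k IHk]; first by rewrite addn0.
by rewrite addnS (submx_trans IHk) ?absorb_mx_mono.
Qed.

(** The space is the inverse image, under B^k, of the row space of B^(k+1), which is
    contained in that of B^k.  Stated additively to avoid truncated subtraction. *)
Lemma rank_absorb_mx B k :
  (\rank (absorb_mx B k) + \rank (B ^+ k) = m + \rank (B ^+ k.+1))%N.
Proof.
have sub : (B ^+ k.+1 <= B ^+ k)%MS by rewrite expmxS submxMl.
have := mxrank_mul_ker (B ^+ k) (cokermx (B ^+ k.+1)).
have -> : \rank (B ^+ k :&: kermx (cokermx (B ^+ k.+1)))%MS = \rank (B ^+ k.+1).
  apply/eqP; rewrite eqn_leq !mxrankS //.
    by rewrite sub_capmx sub sub_kermx mulmx_coker /=.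
  apply: submx_trans (capmxSr _ _) _.
  by rewrite submxE mulmx_ker.
rewrite absorb_mx.unlock mxrank_ker => e.
have := rank_leq_row (B ^+ k *m cokermx (B ^+ k.+1)).
by move: (\rank (_ *m _)) e => r; lia.
Qed.

(** The powers of the extension have u B^k as their only new nonzero row. *)
Lemma rank_ext_mxX u B k :
  \rank (ext_mx u B ^+ k.+1) =
  (~~ (u <= absorb_mx B k)%MS + \rank (B ^+ k.+1))%N.
Proof.
rewrite ext_mxX /block_mx -addsmxE.
rewrite -[in LHS](addsmxC (row_mx 0 (B ^+ k.+1))) addsmxE.
rewrite -block_mxEv block_mxEh col_mx0 rank_row_0mx -addsmxE absorb_mxP.
set x := u *m _; set C := B ^+ _.
have [xC|xC] /= := boolP (x <= C)%MS.
  by apply: eqmx_rank; rewrite addsmx_sub submx_refl xC addsmxSl.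
have := mxrank_sum_cap C x.
have x0 : x != 0 by apply: contraNneq xC => ->; rewrite sub0mx.
have -> : \rank (C :&: x)%MS = 0%N; last by rewrite rank_rV x0; lia.
apply/eqP; rewrite mxrank_eq0; apply/rowV0P => v; rewrite sub_capmx.
move=> /andP[vC /sub_rVP[a va]]; rewrite va in vC *.
have [->|a0] := eqVneq a 0; first by rewrite scale0r.
by rewrite (eqmx_scale _ a0) (negPf xC) in vC.
Qed.

End Extension.

Section Flag.
Variable F : fieldType.

Lemma strictly_upper_ext m (u : 'rV[F]_m) B :
  strictly_upper (ext_mx u B) = strictly_upper B.
Proof.
apply/forallP/forallP => su i; apply/forallP => j; apply/implyP => le_ji.
  have /forallP/(_ (rshift 1 j))/implyP := su (rshift 1 i).
  by rewrite block_mxEdr; apply; rewrite leq_add2l.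
have [i' Ei|i' Ei] := splitP i; have [j' Ej|j' Ej] := splitP j.
- have -> : i = lshift m i' by apply: val_inj.
  have -> : j = lshift m j' by apply: val_inj.
  by rewrite block_mxEul mxE.
- by have := ltn_ord i'; lia.
- have -> : i = rshift 1 i' by apply: val_inj.
  have -> : j = lshift m j' by apply: val_inj.
  by rewrite block_mxEdl mxE.
- have -> : i = rshift 1 i' by apply: val_inj.
  have -> : j = rshift 1 j' by apply: val_inj.
  rewrite block_mxEdr.
  by have /forallP/(_ j')/implyP := su i'; apply; lia.
Qed.

Lemma ext_mxK m (A : 'M[F]_(1 + m)) :
  strictly_upper A -> ext_mx (ursubmx A) (drsubmx A) = A.
Proof.
move=> /forallP su; rewrite -[RHS]submxK /ext_mx; congr block_mx.
  by apply/matrixP=> i j; rewrite !mxE; apply/esym/eqP;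
     have /forallP/(_ (lshift m j))/implyP := su (lshift m i); apply;
     rewrite /= !ord1.
by apply/matrixP=> i j; rewrite !mxE; apply/esym/eqP;
   have /forallP/(_ (lshift m j))/implyP := su (rshift 1 i); apply;
   rewrite /= !ord1.
Qed.

Lemma strictly_upperX0 m (A : 'M[F]_m) : strictly_upper A -> A ^+ m = 0.
Proof.
elim: m A => [|m IHm] A su; first by apply/matrixP => -[].
move: (su); rewrite -(@ext_mxK m A su) strictly_upper_ext => {}su.
by rewrite ext_mxX exprSr (IHm _ su) mul0r mulmx0 block_mx0.
Qed.

End Flag.

Definition lower_at (c : nat -> nat) (j : nat) : nat -> nat :=
  fun k => (c k - (k == j))%N.

(** As the spaces [absorb_mx B k] increase with k, it is enough to exclude the
    index before j for j to be the first one. *)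
Definition absorbed_at (F : fieldType) (m : nat) (u : 'rV[F]_m) (B : 'M[F]_m)
    (j : nat) : bool :=
  (u <= absorb_mx B j)%MS && ((0 < j)%N ==> ~~ (u <= absorb_mx B j.-1)%MS).

Section Absorption.
Variables (F : fieldType) (m : nat).
Implicit Types (u : 'rV[F]_m) (B : 'M[F]_m).

Lemma absorbed_atP u B j k :
  absorbed_at u B j -> (u <= absorb_mx B k)%MS = (j <= k)%N.
Proof.
case/andP=> uj /implyP notuj; apply/idP/idP => [uk|le_jk].
  rewrite leqNgt; apply/negP => lt_kj; have j0 : (0 < j)%N by lia.
  case/negP: (notuj j0); apply: submx_trans uk (absorb_mx_le _ _).
  by lia.
by apply: submx_trans uj (absorb_mx_le _ le_jk).
Qed.

Lemma absorbed_at_uniq u B i j : absorbed_at u B i -> absorbed_at u B j -> i = j.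
Proof.
move=> hi hj; apply/eqP; rewrite eqn_leq.
rewrite -(absorbed_atP _ hi) -(absorbed_atP _ hj).
by case/andP: hi => -> _; case/andP: hj => -> _.
Qed.

Lemma absorbed_at_exists u B : B ^+ m = 0 ->
  exists2 j, (j <= m)%N & absorbed_at u B j.
Proof.
move=> B0; have hm : (u <= absorb_mx B m)%MS by rewrite absorb_mxP B0 mulmx0 sub0mx.
have ex : exists j, (u <= absorb_mx B j)%MS by exists m.
case: (ex_minnP ex) => j hj jmin; exists j; first exact: jmin.
rewrite /absorbed_at hj; apply/implyP => j0; apply/negP => /jmin.
by lia.
Qed.

Lemma rank_ext_mxX_absorbed u B j k : absorbed_at u B j ->
  \rank (ext_mx u B ^+ k) = ((k <= j) + \rank (B ^+ k))%N.
Proof.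
move=> hj; case: k => [|k]; first by rewrite !expr0 !mxrank1.
by rewrite rank_ext_mxX (absorbed_atP _ hj) -ltnNge.
Qed.

(** The rank of the k-th power grows by one for k <= j and by zero for k > j, so only
    the drop at j changes: the extension adds a box in column j. *)
Lemma rank_drops_ext K c u B j : (j < K)%N -> absorbed_at u B j ->
  rank_drops K c (ext_mx u B) = (0 < c j)%N && rank_drops K (lower_at c j) B.
Proof.
move=> lt_jK hj.
have dec k : (\rank (B ^+ k.+1) <= \rank (B ^+ k))%N.
  by rewrite expmxS mxrankM_maxr.
have E (k : nat) : \rank (ext_mx u B ^+ k) == (c k + \rank (ext_mx u B ^+ k.+1))%N
    = ((k == j) + \rank (B ^+ k) == c k + \rank (B ^+ k.+1))%N.
  by rewrite !(rank_ext_mxX_absorbed _ hj); case: (ltngtP k j) => ?; lia.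
apply/forallP/andP => [dr|[cj /forallP dr] k].
  have := dr (Ordinal lt_jK); rewrite E eqxx => /eqP drj.
  have cj : (0 < c j)%N by have := dec j; move: drj => /=; lia.
  split=> //; apply/forallP => k; have := dr k; rewrite E /lower_at.
  by case: (nat_of_ord k =P j) => [->|_]; lia.
have := dr k; rewrite E /lower_at.
by case: (nat_of_ord k =P j) => [->|_]; lia.
Qed.

Lemma rank_absorb_mx_drops K c B j : (j < K)%N -> rank_drops K c B ->
  (\rank (absorb_mx B j) = m - c j)%N.
Proof.
move=> lt_jK /forallP/(_ (Ordinal lt_jK))/eqP /= r.
by have := rank_absorb_mx B j; lia.
Qed.

End Absorption.

(** * Counting by rank drops *)

Section Count.
Variable F : finFieldType.

Definition drops_count (K m : nat) (c : nat -> nat) : nat :=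
  #|[set A : 'M[F]_m | strictly_upper A & rank_drops K c A]|.

(** The difference of the cardinals of two consecutive members of the flag of spaces
    [absorb_mx B k], whose dimensions are m - c j.-1 and m - c j when B has rank
    drops c. *)
Definition absorb_poly (m : nat) (c : nat -> nat) (j : nat) : {poly int} :=
  'X^(m - c j) - (0 < j)%:R *: 'X^(m - c j.-1).

Lemma card_absorbed_at K c m (B : 'M[F]_m) j : (j < K)%N -> rank_drops K c B ->
  #|[set u : 'rV[F]_m | absorbed_at u B j]|%:Z = (absorb_poly m c j).[#|F|%:Z].
Proof.
move=> lt_jK dr.
have cardS k : (k < K)%N -> #|rowg (absorb_mx B k)|%:Z = #|F|%:Z ^+ (m - c k).
  by move=> ltk; rewrite card_rowg (rank_absorb_mx_drops ltk dr) -[LHS]natz natrX natz.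
rewrite /absorb_poly hornerD hornerN hornerZ !hornerXn.
case: j lt_jK => [|j] lt_jK /=.
  rewrite mul0r subr0 -cardS //; congr (Posz #|pred_of_set _|).
  by apply/setP => u; rewrite !inE /absorbed_at andbT.
rewrite mul1r -!cardS //; last by lia.
rewrite (_ : [set u | _] = rowg (absorb_mx B j.+1) :\: rowg (absorb_mx B j)).
  have sub : rowg (absorb_mx B j) \subset rowg (absorb_mx B j.+1).
    by rewrite rowgS absorb_mx_mono.
  by rewrite (cardsDS sub) subzn // (subset_leq_card sub).
by apply/setP => u; rewrite !inE /absorbed_at andbC.
Qed.

(** Each u is absorbed at exactly one index, which is below K because B is
    nilpotent. *)
Lemma card_ext_drops K m c (B : 'M[F]_m) : (m < K)%N -> strictly_upper B ->
  (\sum_(u : 'rV[F]_m | rank_drops K c (ext_mx u B)) 1 =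
   \sum_(j < K | (0 < c j) && rank_drops K (lower_at c j) B)
      #|[set u : 'rV[F]_m | absorbed_at u B j]|)%N.
Proof.
move=> lt_mK su.
pose p u : 'I_K := odflt (Ordinal lt_mK) [pick j : 'I_K | absorbed_at u B j].
have pP u : absorbed_at u B (p u).
  rewrite /p; case: pickP => //= no.
  have [j le_jm hj] := absorbed_at_exists u (strictly_upperX0 su).
  by have := no (Ordinal (leq_ltn_trans le_jm lt_mK)); rewrite /= hj.
rewrite (partition_big p
  (fun j : 'I_K => (0 < c j)%N && rank_drops K (lower_at c j) B)) /=; last first.
  by move=> u; rewrite (rank_drops_ext _ _ (pP u)).
apply: eq_bigr => j dr; rewrite -sum1dep_card; apply: eq_bigl => u.
apply/andP/idP => [[_ /eqP <-] //|hj].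
by rewrite (rank_drops_ext _ _ hj) // dr -val_eqE /= (absorbed_at_uniq hj (pP u)).
Qed.

(** The recursion of the counting functions: every strictly upper triangular matrix
    of size m + 1 is a unique extension of one of size m. *)
Lemma drops_countS K m c : (m < K)%N ->
  (drops_count K m.+1 c)%:Z =
  \sum_(j < K | (0 < c j)%N)
     (drops_count K m (lower_at c j))%:Z * (absorb_poly m (lower_at c j) j).[#|F|%:Z].
Proof.
move=> lt_mK; rewrite /drops_count.
have -> : #|[set A : 'M[F]_m.+1 | strictly_upper A & rank_drops K c A]| =
  (\sum_(B : 'M[F]_m | strictly_upper B)
     \sum_(u : 'rV[F]_m | rank_drops K c (ext_mx u B)) 1)%N.
  rewrite -sum1dep_card pair_big_dep /=.
  rewrite (reindex_onto (fun p : 'M[F]_m * 'rV[F]_m => ext_mx p.2 p.1)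
    (fun A : 'M[F]_(1 + m) => (drsubmx A, ursubmx A))) /=; last first.
    by move=> A /andP[su _]; rewrite ext_mxK.
  apply: eq_bigl => -[B u] /=.
  by rewrite strictly_upper_ext block_mxKdr block_mxKur eqxx andbT.
under eq_bigr => B su do rewrite (card_ext_drops _ lt_mK su).
rewrite -natz natr_sum.
under eq_bigr => B su.
  rewrite natr_sum.
  under eq_bigr => j /andP[_ dr] do
    rewrite natz (card_absorbed_at (ltn_ord j) dr).
  over.
rewrite (exchange_big_dep (fun j : 'I_K => (0 < c j)%N)) /=; last first.
  by move=> B j _ /andP[].
apply: eq_bigr => j cj; rewrite -sum1dep_card -[X in _ = X * _]natz natr_sum.
by rewrite mulr_suml; apply: eq_big => [B|B _]; rewrite ?cj ?mul1r.
Qed.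

End Count.

(** * The exact power of q *)

(** If lam' is the sequence c and n is the weight of lam, the exact power of q in the
    counting polynomial is C(n, 2) minus this number. *)
Definition deficit (K : nat) (c : nat -> nat) : nat :=
  ('C(c 0, 2) + \sum_(k < K) c k * c k.+1)%N.

(** The last summand is what separates the corners: it vanishes only for the corner
    in the last column.  The middle one compensates the exponent m - c j.-1 of
    [absorb_polyE], taken for the lowered sequence. *)
Lemma deficit_lower K c j : (j < K)%N -> (0 < c j)%N ->
  deficit K c =
  (deficit K (lower_at c j) + lower_at c j j.-1 + c j.+1)%N.
Proof.
move=> lt_jK cj; rewrite /deficit.
set c' := lower_at c j.
have E k : c k = (c' k + (k == j))%N by rewrite /c' /lower_at; case: eqP => [->|]; lia.
have delta (f : nat -> nat) i : (i < K)%N -> (\sum_(k < K) (k == i :> nat) * f k = f i)%N.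
  move=> lt_iK; rewrite (bigD1 (Ordinal lt_iK)) //= eqxx mul1n big1 ?addn0 // => k.
  by rewrite -val_eqE /= => /negPf->.
have -> : (\sum_(k < K) c k * c k.+1 = \sum_(k < K) c' k * c' k.+1
   + \sum_(k < K) (k == j :> nat) * c' k.+1 + \sum_(k < K) (k.+1 == j :> nat) * c' k)%N.
  rewrite -!big_split; apply: eq_bigr => k _ /=; rewrite !E.
  by case: (k =P j :> nat) => [->|_]; case: (k.+1 =P j :> nat) => [|_]; lia.
rewrite (delta (fun k => c' k.+1)) // (E j.+1) (_ : (j.+1 == j) = false); last by lia.
case: j lt_jK cj @c' E delta => [|j] lt_jK cj c' E delta /=.
  rewrite (E 0%N) /= addn1 binS bin1 [X in (_ + (_ + X) = _)%N]big1 ?addn0 //.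
  by move: (\sum_(k < K) _)%N => S; lia.
rewrite (delta (fun k => c' k)) ?(ltnW lt_jK) // (E 0%N) /= !addn0.
by move: (\sum_(k < K) _)%N => S; lia.
Qed.

(** The lowest exponent comes from the negative term if j > 0; the column j - 1 is
    strictly longer than column j, and so the two exponents differ. *)
Lemma absorb_polyE m c j : (c j.-1 <= m)%N -> ((0 < j)%N -> (c j < c j.-1)%N) ->
  exists2 H : {poly int}, H.[0] != 0 & absorb_poly m c j = 'X^(m - c j.-1) * H.
Proof.
case: j => [|j] /= cm cj.
  by exists 1; rewrite ?hornerC // /absorb_poly scale0r subr0 mulr1.
have {}cj := cj isT.
exists ('X^(c j - c j.+1) - 1).
  by rewrite hornerD hornerN hornerXn hornerC expr0n subn_eq0 leqNgt cj.
rewrite /absorb_poly scale1r mulrBr mulr1 -exprD; congr ('X^_ - _); lia.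
Qed.

(** Rank drops never increase, since [absorb_mx] is an increasing flag.  This removes
    from the recursion the columns that do not end in a corner. *)
Lemma drops_count_eq0 (F : finFieldType) K m c j :
  (j.+1 < K)%N -> (c j < c j.+1)%N -> drops_count F K m c = 0%N.
Proof.
move=> ltjK cj; apply/eqP; rewrite cards_eq0; apply/eqP/setP => A.
rewrite !inE; apply/negP => /andP[_ dr].
have := mxrankS (absorb_mx_mono A j).
have /forallP/(_ (Ordinal ltjK))/eqP /= := dr.
have /forallP/(_ (Ordinal (ltnW ltjK)))/eqP /= := dr.
have := rank_absorb_mx A j; have := rank_absorb_mx A j.+1; lia.
Qed.

Lemma sum_polyX_mul K (P : pred 'I_K) (f : 'I_K -> finFieldType -> int) d :
  (forall j, P j -> exists R : {poly int},
     forall F : finFieldType, f j F = ('X^d * R).[#|F|%:Z]) ->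
  exists R : {poly int},
    forall F : finFieldType, \sum_(j | P j) f j F = ('X^d * R).[#|F|%:Z].
Proof.
move=> fR.
have {fR}/fin_all_exists[R RP] : forall j : 'I_K, exists R : {poly int},
    P j -> forall F : finFieldType, f j F = ('X^d * R).[#|F|%:Z].
  move=> j; case: (boolP (P j)) => [/fR[R fE]|_]; last by exists 0.
  by exists R.
exists (\sum_(j | P j) R j) => F; rewrite mulr_sumr horner_sum.
by apply: eq_bigr => j /RP->.
Qed.

(** The hypotheses on c say that it is the dual of a partition of m.  The condition
    R.[0] != 0 makes d the exact exponent; it survives the recursion because the
    lowest exponent occurs in one term only, that of the last column. *)
Lemma drops_count_poly K m c :
  (m <= K)%N -> (forall k, (c k.+1 <= c k)%N) -> c K = 0%N ->
  (\sum_(k < K) c k)%N = m ->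
  exists d (R : {poly int}), [/\ R.[0] != 0,
    (d + deficit K c = 'C(m, 2))%N &
    forall F : finFieldType, (drops_count F K m c)%:Z = ('X^d * R).[#|F|%:Z]].
Proof.
elim: m c => [|m IHm] c le_mK c_dec cK sum_c.
  have c0 k : c k = 0%N.
    (* beyond K the sequence vanishes because it decreases from c K = 0 *)
    have [ltkK|leKk] := ltnP k K.
      have : (c k <= \sum_(k < K) c k)%N by rewrite (bigD1 (Ordinal ltkK)) //= leq_addr.
      by rewrite sum_c; lia.
    elim: k leKk => [|k IHk]; first by case: (K) cK.
    by rewrite leq_eqVlt => /orP[/eqP<- //|/IHk]; have := c_dec k; lia.
  exists 0%N, 1; split; first by rewrite hornerC.
    by rewrite /deficit c0 big1 // => k _; rewrite c0.
  move=> F; rewrite mulr1 expr0 hornerC /drops_count; congr Posz.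
  rewrite (_ : [set A | _] = [set 0]) ?cards1 //; apply/setP => A.
  rewrite !inE [A]thinmx0 eqxx; apply/andP; split.
    by apply/forallP => -[].
  by apply/forallP => k; rewrite c0 ![_ ^+ _]thinmx0.
have c_le i j : (i <= j)%N -> (c j <= c i)%N.
  by move/subnKC<-; elim: (j - i)%N => [|k IHk]; rewrite ?addn0 // addnS;
     have := c_dec (i + k)%N; lia.
have lower_sum j : (j < K)%N -> (0 < c j)%N ->
    (\sum_(k < K) lower_at c j k)%N = m.
  move=> ltjK cj; apply/eq_add_S; rewrite -sum_c (bigD1 (Ordinal ltjK)) //=.
  rewrite [in RHS](bigD1 (Ordinal ltjK)) //= -addSn {1}/lower_at eqxx subn1 prednK //; congr (_ + _)%N.
  apply: eq_bigr => k; rewrite -val_eqE /= /lower_at => /negPf->.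
  by rewrite subn0.
(* the exponent contributed by a corner exceeds the claimed one by c j.+1 *)
have term j : (j < K)%N -> (c j.+1 < c j)%N ->
   exists d (R : {poly int}), [/\ R.[0] != 0,
    (d + deficit K c = 'C(m.+1, 2) + c j.+1)%N &
    forall F : finFieldType, (drops_count F K m (lower_at c j))%:Z *
      (absorb_poly m (lower_at c j) j).[#|F|%:Z] = ('X^d * R).[#|F|%:Z]].
  move=> ltjK cj; have cj0 : (0 < c j)%N by lia.
  have [||||d [R [R0 dE RE]]] := IHm (lower_at c j); first by lia.
  - move=> k; rewrite /lower_at; have := c_dec k.
    by case: (k =P j) => [->|_]; case: (k.+1 =P j); lia.
  - by rewrite /lower_at cK.
  - exact: lower_sum.
  have bnd : (lower_at c j j.-1 <= m)%N.
    have lt1 : (j.-1 < K)%N by lia.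
    by rewrite -(lower_sum j) // (bigD1 (Ordinal lt1)) //= leq_addr.
  have [||H H0 HE] := @absorb_polyE m (lower_at c j) j; first by [].
    move=> j0; rewrite /lower_at eqxx (_ : (j.-1 == j) = false); last by lia.
    by have := c_le j.-1 j; lia.
  exists (d + (m - lower_at c j j.-1))%N, (R * H); split.
  - by rewrite hornerM mulf_neq0.
  - by rewrite (deficit_lower ltjK cj0) binS bin1; lia.
  by move=> F; rewrite RE HE -hornerM exprD; congr (_.[_]); rewrite mulrACA.
(* the last nonempty column J is a corner with c J.+1 = 0 *)
have [J ltJK /andP[cJ cJ1]] : exists2 J, (J < K)%N & (0 < c J)%N && (c J.+1 == 0)%N.
  have ex : exists k, c k == 0%N by exists K; rewrite cK.
  case: (ex_minnP ex) => -[|J] /eqP cJ minJ.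
    suff : (\sum_(k < K) c k = 0)%N by rewrite sum_c.
    by rewrite big1 // => k _; have := c_le 0%N k; lia.
  exists J; first by apply: minJ; rewrite cK.
  by rewrite cJ eqxx andbT lt0n; apply/negP => /minJ; lia.
have [|d [R [R0 dE RE]]] := term J ltJK; first by lia.
have [R' R'E] : exists R' : {poly int}, forall F : finFieldType,
  \sum_(j < K | (0 < c j)%N && (j != Ordinal ltJK)) (drops_count F K m (lower_at c j))%:Z *
      (absorb_poly m (lower_at c j) j).[#|F|%:Z] = ('X^(d.+1) * R').[#|F|%:Z].
  apply: (@sum_polyX_mul _ _ (fun j F => (drops_count F K m (lower_at c j))%:Z *
      (absorb_poly m (lower_at c j) j).[#|F|%:Z])) => j /andP[cj neqJ].
  have [corner|flat] := ltnP (c j.+1) (c j); last first.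
    exists 0 => F; rewrite (@drops_count_eq0 _ _ _ _ j) ?mul0r ?mulr0 ?horner0 //.
      have : j.+1 != K by apply: contraTneq flat => ->; rewrite cK; lia.
      by have := ltn_ord j; lia.
    by rewrite /lower_at eqxx (_ : (j.+1 == j) = false); lia.
  have [dj [Rj [_ djE RjE]]] := term j (ltn_ord j) corner.
  have cj1 : (0 < c j.+1)%N.
    rewrite lt0n; apply: contraNneq neqJ => cj1; rewrite -val_eqE /=.
    rewrite eqn_leq; apply/andP; split; rewrite leqNgt; apply/negP => lt.
      by have := c_le J.+1 j lt; lia.
    by have := c_le j.+1 J lt; lia.
  exists ('X^(dj - d.+1) * Rj) => F; rewrite RjE mulrA -exprD subnKC //.
  lia.
(* modulo 'X the cofactor is that of the term of column J, whence R.[0] != 0 *)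
exists d, (R + 'X * R'); split.
- by rewrite hornerD hornerM hornerX mul0r addr0.
- lia.
move=> F; rewrite drops_countS // (bigD1 (Ordinal ltJK)) //= RE R'E -hornerD.
by congr (_.[_]); rewrite mulrDr mulrA -exprSr.
Qed.

(** * Jordan type and ranks of powers *)

Section JordanMatrix.
Variable F : fieldType.

Lemma jordan_blockX m k :
  jordan_block F m ^+ k = \matrix_(i, j) (j == (i + k)%N :> nat)%:R.
Proof.
elim: k => [|k IHk].
  by apply/matrixP => i j; rewrite expr0 !mxE addn0 eq_sym.
rewrite exprS IHk; apply/matrixP => i j; rewrite !mxE.
have [lt_im|le_mi] := ltnP i.+1 m.
  rewrite (bigD1 (Ordinal lt_im)) //= !mxE eqxx mul1r addSnnS big1 ?addr0 // => l.
  by rewrite -val_eqE /= !mxE => /negPf->; rewrite mul0r.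
rewrite big1 => [|l _]; last first.
  by rewrite !mxE (_ : (l == i.+1 :> nat) = false) ?mul0r //; have := ltn_ord l; lia.
by rewrite (_ : (j == (i + k.+1)%N :> nat) = false) //; have := ltn_ord j; lia.
Qed.

Lemma ker_jordan_block m (w : 'rV[F]_m) (k : 'I_m) :
  w *m jordan_block F m = 0 -> (k.+1 < m)%N -> w 0 k = 0.
Proof.
move=> wJ ltk; have /rowP/(_ (Ordinal ltk)) := wJ.
rewrite mxE (bigD1 k) //= !mxE /= eqxx mulr1 big1 ?addr0 // => l.
by rewrite -val_eqE /= !mxE /= eqSS eq_sym => /negPf->; rewrite mulr0.
Qed.

Lemma rank_jordan_blockX m k : \rank (jordan_block F m ^+ k) = (m - k)%N.
Proof.
rewrite jordan_blockX; set E := \matrix_(i, j) _.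
have rpid : \rank (pid_mx (m - k) : 'M[F]_m) = (m - k)%N.
  by rewrite rank_pid_mx ?leq_subr.
apply/eqP; rewrite eqn_leq -[X in _ && (X <= _)%N]rpid -[X in (_ <= X)%N && _]rpid.
apply/andP; split.
  suff {1}-> : E = pid_mx (m - k) *m E by apply: mxrankM_maxl.
  apply/matrixP => i j; rewrite !mxE (bigD1 i) //= !mxE eqxx /=.
  rewrite big1 ?addr0 => [|l]; last first.
    by rewrite -val_eqE eq_sym !mxE /= => /negPf->; rewrite mul0r.
  by case: eqP => [Ej|_]; rewrite ?mulr0 // mulr1 (_ : (i < m - k)%N) //;
     have := ltn_ord j; lia.
(* multiplying the shift by its transpose bounds its rank from below *)
suff -> : pid_mx (m - k) = E *m E^T by apply: mxrankM_maxl.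
apply/matrixP => i i'; rewrite !mxE.
have [lt|ge] := ltnP i (m - k)%N.
  have ltm : (i + k < m)%N by lia.
  rewrite (bigD1 (Ordinal ltm)) //= !mxE eqxx mul1r eqn_add2r andbT.
  rewrite big1 ?addr0 // => l.
  by rewrite -val_eqE !mxE /= => /negPf->; rewrite mul0r.
rewrite andbF big1 // => l _; rewrite !mxE (_ : (l == (i + k)%N :> nat) = false).
  by rewrite mul0r.
by have := ltn_ord l; lia.
Qed.

Lemma jordan_mxX lam k :
  jordan_mx F lam ^+ k =
  \mxdiag_(i < size lam) (jordan_block F (nth 0%N lam i) ^+ k).
Proof.
elim: k => [|k IHk].
  by rewrite expr0; under eq_mxdiag do rewrite expr0; rewrite mxdiagZ.
rewrite exprS IHk /jordan_mx -mulmxE [X in _ *m X]/mxdiag mul_mxdiag_mxblock.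
apply/eq_mxblockP => i j; case: eqP => [<-|_]; last by rewrite mulmx0.
by rewrite !conform_mx_id exprS.
Qed.

Lemma rank_jordan_mxX lam k :
  \rank (jordan_mx F lam ^+ k) = (\sum_(i < size lam) (nth 0 lam i - k))%N.
Proof.
by rewrite jordan_mxX rank_mxdiag; apply: eq_bigr => i _; rewrite rank_jordan_blockX.
Qed.

Lemma rank_drops_jordan_mx lam k :
  \rank (jordan_mx F lam ^+ k) =
  (count (leq k.+1) lam + \rank (jordan_mx F lam ^+ k.+1))%N.
Proof.
rewrite !rank_jordan_mxX -sum1_count (big_nth 0%N) big_mkord.
rewrite [X in (X + _)%N]big_mkcond -big_split /=.
by apply: eq_bigr => i _ /=; case: ltnP; lia.
Qed.

Lemma similar_rankX n (S A B : 'M[F]_n) k :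
  S \in unitmx -> similar S A B -> \rank (A ^+ k) = \rank (B ^+ k).
Proof.
move=> Su /(similarP Su) SA.
have SAk : S *m A ^+ k = B ^+ k *m S.
  elim: k => [|k IHk]; first by rewrite !expr0 mulmx1 mul1mx.
  by rewrite !exprSr -!mulmxE mulmxA IHk -!mulmxA SA.
rewrite -(mxrankMfree (B ^+ k) (B := S)) ?row_free_unit // -SAk.
by rewrite eqmxMfull ?row_full_unit.
Qed.

End JordanMatrix.

Lemma nth_part_le lam i j :
  is_partition lam -> (i <= j)%N -> (nth 0 lam j <= nth 0 lam i)%N.
Proof.
case/andP=> srt _ le_ij.
have [ltj|gej] := ltnP j (size lam); last by rewrite nth_default.
have geq_trans : transitive geq by move=> x y z /= h1 h2; apply: leq_trans h2 h1.
apply: (sorted_leq_nth geq_trans) => //; first by move=> x /=.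
by rewrite inE; apply: leq_ltn_trans ltj.
Qed.

Section JordanBasis.
Variables (F : fieldType) (n : nat) (lam : seq nat) (A : 'M[F]_n).
Hypothesis lam_part : is_partition lam.
Hypothesis drops : forall k,
  \rank (A ^+ k) = (count (leq k.+1) lam + \rank (A ^+ k.+1))%N.

Lemma part_gt0 i : (i < size lam)%N -> (0 < nth 0 lam i)%N.
Proof. by move=> lti; case/andP: lam_part => _ /all_nthP; apply. Qed.

Lemma count_part p : (p < size lam)%N -> (p < count (leq (nth 0 lam p)) lam)%N.
Proof.
move=> ltp; rewrite -[X in count _ X](cat_take_drop p.+1) count_cat.
suff /eqP-> : count (leq (nth 0%N lam p)) (take p.+1 lam) == p.+1 by rewrite leq_addr.
have sz : size (take p.+1 lam) = p.+1 by rewrite size_takel.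
rewrite -{2}sz -all_count; apply/(all_nthP 0%N) => i; rewrite sz => lti.
by rewrite nth_take // nth_part_le.
Qed.

(** The vectors v i are the tops of the Jordan chains and v i A^(lam_i - 1) their
    last vectors.  The kernel of A meets the image of A^(l-1) in a space whose
    dimension is the number of parts of size at least l; for l = lam_p this
    exceeds p, as lam is non-increasing, so a last vector for chain p can be
    chosen outside the span of the p previous ones.  Families are indexed by nat
    to make the induction on p free of ordinal casts. *)
Lemma jordan_chain_tops p : (p <= size lam)%N ->
  exists v : nat -> 'rV[F]_n,
    (forall i, (i < p)%N -> v i *m A ^+ nth 0%N lam i = 0) /\
    (forall a : nat -> F,
       \sum_(i < p) a i *: (v i *m A ^+ (nth 0%N lam i).-1) = 0 ->
       forall i, (i < p)%N -> a i = 0).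
Proof.
elim: p => [|p IHp] ltp; first by exists (fun=> 0); split.
have [v [v0 v_free]] := IHp (ltnW ltp).
set w := fun i => v i *m A ^+ (nth 0%N lam i).-1 in v_free *.
pose l := (nth 0%N lam p).-1.
have El : nth 0%N lam p = l.+1 by rewrite prednK // part_gt0.
have /row_subPn[r] : ~~ (A ^+ l :&: kermx A <= \matrix_(r < p) w r)%MS.
  apply/negP => /mxrankS; have := rank_leq_row (\matrix_(r < p) w r).
  have := mxrank_mul_ker (A ^+ l) A; rewrite -expmxSr (drops l).
  by have := count_part ltp; rewrite El; lia.
set x := row r _ => x_out.
have : (x <= A ^+ l :&: kermx A)%MS by apply: row_sub.
rewrite sub_capmx => /andP[/submxP[y xE] /sub_kermxP xA].
exists (fun i => if i == p then y else v i); split=> [i|a].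
  rewrite ltnS leq_eqVlt; case: eqP => [->|_] /=; last exact: v0.
  by rewrite El expmxSr mulmxA -xE.
rewrite big_ord_recr /= eqxx -/l -xE.
under eq_bigr => i _ do rewrite (ltn_eqF (ltn_ord i)) -/(w i).
move=> sum0.
have ap : a p = 0.
  apply: contraNeq x_out => ap.
  rewrite -(eqmx_scale _ ap) -[_ *: _](addrK (\sum_(i < p) a i *: w i)).
  rewrite [_ + \sum_(i < p) _]addrC sum0 sub0r eqmx_opp summx_sub // => i _.
  by apply: scalemx_sub; apply: (eq_row_sub i); rewrite rowK.
rewrite ap scale0r addr0 in sum0.
by move=> i; rewrite ltnS leq_eqVlt => /orP[/eqP->//|]; apply: v_free.
Qed.

End JordanBasis.

(** The rows of the base change S are the vectors of the chains.  The left kernel of S is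
    stable under the nilpotent Jordan matrix J; were it nonzero, it would contain a
    nonzero vector killed by J.  Such a vector has its support on the ends of the
    blocks, and this contradicts the independence of the last vectors. *)
Lemma similar_jordan_mx (F : fieldType) lam (A : 'M[F]_(weight lam)) :
  is_partition lam ->
  (forall k, \rank (A ^+ k) = (count (leq k.+1) lam + \rank (A ^+ k.+1))%N) ->
  exists2 S, S \in unitmx & similar S A (jordan_mx F lam).
Proof.
move=> lam_part drops.
have [v [v0 v_free]] := jordan_chain_tops lam_part drops (leqnn _).
pose C i := \matrix_(k < nth 0%N lam i) (v i *m A ^+ k).
pose S : 'M[F]_(weight lam) := \mxcol_(i < size lam) C i.
have JS : jordan_mx F lam *m S = S *m A.
  rewrite mul_mxdiag_mxcol /S mxcol_mul; apply/eq_mxcol => i.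
  apply/row_matrixP => k; rewrite !row_mul rowK -mulmxA -expmxSr mulmx_sum_row.
  have [ltk|gek] := ltnP k.+1 (nth 0%N lam i).
    rewrite (bigD1 (Ordinal ltk)) //= rowK !mxE eqxx scale1r big1 ?addr0 // => l.
    by rewrite -val_eqE /= !mxE => /negPf->; rewrite scale0r.
  rewrite (_ : k.+1 = nth 0%N lam i) ?v0 //; last by have := ltn_ord k; lia.
  rewrite big1 // => l _; rewrite !mxE (_ : (l == k.+1 :> nat) = false) ?scale0r //.
  by have := ltn_ord l; lia.
have ker1 (u : 'rV[F]_(weight lam)) : u *m jordan_mx F lam = 0 -> u *m S = 0 -> u = 0.
  pose ub (i : 'I_(size lam)) : 'rV[F]_(nth 0%N lam i) := submxrow u i.
  have Eu : u = \mxrow_i ub i by rewrite submxrowK.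
  rewrite {1 2}Eu mul_mxrow_mxdiag mul_mxrow_mxcol => uJ uS.
  have uJi i : ub i *m jordan_block F (nth 0%N lam i) = 0.
    have /mxrowP/(_ i) := uJ; rewrite mxrowK => ->.
    by rewrite submxrow0.
  have inner (i : 'I_(size lam)) (k : 'I_(nth 0%N lam i)) : (k.+1 < nth 0%N lam i)%N -> ub i 0 k = 0.
    by move=> ltk; apply: ker_jordan_block ltk; apply: uJi.
  have last_lt (i : 'I_(size lam)) : ((nth 0%N lam i).-1 < nth 0%N lam i)%N.
    by have := part_gt0 lam_part (ltn_ord i); lia.
  pose z (i : 'I_(size lam)) : 'I_(nth 0%N lam i) := Ordinal (last_lt i).
  have not_last (i : 'I_(size lam)) k : k != z i -> ub i 0 k = 0.
    by rewrite -val_eqE /= => kz; apply: inner; have := ltn_ord k; lia.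
  (* the coefficient at the end of block i, extended by 0 to all of nat *)
  pose a (i : nat) := \sum_(i' < size lam | i' == i :> nat) ub i' 0 (z i').
  have aE (i : 'I_(size lam)) : a i = ub i 0 (z i) by apply: big_pred1.
  have a0 : forall i, (i < size lam)%N -> a i = 0.
    apply: v_free; rewrite -[RHS]uS; apply: eq_bigr => i _.
    rewrite aE [RHS]mulmx_sum_row (bigD1 (z i)) //= rowK big1 ?addr0 // => k kz.
    by rewrite not_last ?scale0r.
  rewrite Eu; apply/mxrowP => i; rewrite mxrowK submxrow0.
  apply/rowP => k; rewrite [RHS]mxE.
  have [->|kz] := eqVneq k (z i); last exact: not_last.
  by rewrite -aE a0.
have nilJ : jordan_mx F lam ^+ weight lam = 0.
  apply/eqP; rewrite -mxrank_eq0 rank_jordan_mxX big1 // => i _.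
  by apply/eqP; rewrite subn_eq0 /weight (bigD1 i) //= leq_addr.
have ker k (u : 'rV[F]_(weight lam)) :
    u *m jordan_mx F lam ^+ k = 0 -> u *m S = 0 -> u = 0.
  elim: k u => [|k IHk] u; first by rewrite expr0 mulmx1.
  rewrite expmxS mulmxA => uJ uS; apply: ker1 => //; apply: IHk => //.
  by rewrite -mulmxA JS mulmxA uS mul0mx.
have Su : S \in unitmx.
  rewrite -row_free_unit; apply: inj_row_free => u uS; apply: (ker (weight lam)) uS.
  by rewrite nilJ mulmx0.
by exists S => //; apply/similarP.
Qed.

Lemma has_jordan_typeP (F : finFieldType) lam (A : 'M[F]_(weight lam)) :
  is_partition lam -> strictly_upper A ->
  has_jordan_type A =
  rank_drops (weight lam) (fun k => count (leq k.+1) lam) A.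
Proof.
move=> lam_part su; apply/exists_inP/forallP => [[S Su sim] k|dr].
  by rewrite !(similar_rankX _ Su sim) rank_drops_jordan_mx.
have [|S Su sim] := @similar_jordan_mx F lam A lam_part; last by exists S.
move=> k; have [ltk|gek] := ltnP k (weight lam).
  by apply/eqP: (dr (Ordinal ltk)).
have nil j : (weight lam <= j)%N -> A ^+ j = 0.
  by move/subnKC <-; rewrite exprD (strictly_upperX0 su) mul0r.
rewrite !nil ?(leqW gek) // !mxrank0 addn0; apply/esym/eqP.
rewrite -leqn0 leqNgt -has_count; apply/hasPn => x /(nthP 0%N)[i lti <-].
rewrite -ltnNge ltnS; apply: leq_trans gek.
by rewrite /weight (bigD1 (Ordinal lti)) //= leq_addr.
Qed.

Lemma jordan_countE (F : finFieldType) lam :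
  is_partition lam ->
  jordan_count F lam =
  drops_count F (weight lam) (weight lam) (fun k => count (leq k.+1) lam).
Proof.
move=> lam_part; apply: eq_card => A; rewrite !inE.
by apply: andb_id2l => su; rewrite has_jordan_typeP.
Qed.

(** * From counts to polynomials *)

(** There are infinitely many prime fields. *)
Lemma eq_poly_on_finFields (P Q : {poly int}) :
  (forall F : finFieldType, P.[#|F|%:Z] = Q.[#|F|%:Z]) -> P = Q.
Proof.
move=> PQ; apply/eqP; rewrite -subr_eq0; apply/negPn/negP => D0.
pose D := P - Q.
have rootD p : prime p -> root D p%:Z.
  move=> pr_p; rewrite /root hornerD hornerN subr_eq0.
  by have := PQ 'F_p; rewrite card_Fp // => ->.
have primes_seq k : exists s : seq nat, [/\ uniq s, all prime s & size s = k].
  elim: k => [|k [s [us ps <-]]]; first by exists [::].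
  have [p lt_p pr_p] := prime_above (\max_(x <- s) x).
  exists (p :: s); split=> //=; last by rewrite pr_p.
  rewrite us andbT; apply: contraTN lt_p => ps'.
  by rewrite -leqNgt (big_rem _ ps') /= leq_maxl.
have [s [us ps sz]] := primes_seq (size D).
suff : D = 0 by apply/eqP.
apply: (@roots_geq_poly_eq0 _ D [seq p%:Z | p <- s]); last by rewrite size_map sz.
  by rewrite all_map; apply: sub_all ps => p; apply: rootD.
by rewrite map_inj_uniq // => x y [].
Qed.

Lemma polyX_mul_inj (A B : {poly int}) a b :
  A.[0] != 0 -> B.[0] != 0 -> 'X^a * A = 'X^b * B -> a = b.
Proof.
wlog: A B a b / (a <= b)%N => [H|le_ab A0 _].
  have [le_ab|lt_ba] := leqP a b => A0 B0 E; first exact: H E.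
  by apply/esym; apply: H (esym E); rewrite // ltnW.
rewrite -(subnKC le_ab) exprD -mulrA => /(mulfI _) E.
move: A0; rewrite E ?expf_neq0 ?polyX_eq0 // hornerM hornerXn expr0n.
by case: (b - a)%N => [|k]; rewrite ?addn0 // mul0r eqxx.
Qed.

Section DualPartition.
Variable lam : seq nat.
Hypothesis lam_part : is_partition lam.

Lemma part_le_head i : (nth 0 lam i <= head 0 lam)%N.
Proof.
by rewrite -nth0 nth_part_le.
Qed.

Lemma count_gt_head k : (head 0 lam <= k)%N -> count (leq k.+1) lam = 0%N.
Proof.
move=> lek; apply/eqP; rewrite -leqn0 leqNgt -has_count.
apply/hasPn => x /(nthP 0%N)[i lti <-].
by rewrite -ltnNge ltnS (leq_trans (part_le_head i)).
Qed.

Lemma nth_dual_part k : nth 0%N (dual_part lam) k = count (leq k.+1) lam.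
Proof.
have [ltk|gek] := ltnP k (head 0%N lam).
  by rewrite (nth_map 0%N) ?size_iota // nth_iota.
by rewrite count_gt_head // nth_default // size_map size_iota.
Qed.

Lemma head_le_weight : (head 0 lam <= weight lam)%N.
Proof. by rewrite /weight; case: lam => //= x s; rewrite big_ord_recl leq_addr. Qed.

(** The columns of the Young diagram have as many boxes in total as its rows. *)
Lemma sum_count_part :
  (\sum_(k < weight lam) count (leq k.+1) lam)%N = weight lam.
Proof.
under eq_bigr do rewrite -sum1_count (big_nth 0%N) big_mkord big_mkcond.
rewrite exchange_big; apply: eq_bigr => i _ /=; rewrite -big_mkcond /=.
have le : (nth 0 lam i <= weight lam)%N.
  exact: leq_trans (part_le_head i) head_le_weight.
by rewrite -(big_ord_widen _ (fun=> 1%N) le) sum1_card card_ord.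
Qed.

End DualPartition.

Theorem theorem4p1 (lam : seq nat) (P R : {poly int}) (d e : nat) :
  is_partition lam -> (0 < weight lam)%N ->
  is_counting_poly lam P -> qQ_factorization P d e R ->
  d%:Z = 'C(weight lam, 2)%:Z - 'C(size lam, 2)%:Z
         - \sum_(0 <= j < (size (dual_part lam)).-1)
             (nth 0%N (dual_part lam) j * nth 0%N (dual_part lam) j.+1)%N%:Z.
Proof.
move=> lam_part n_gt0 countP [PE R0 _].
pose c k := count (leq k.+1) lam.
have [||d' [R' [R'0 d'E R'E]]] := drops_count_poly (c := c) (leqnn _) _ _ (sum_count_part lam_part).
- by move=> k; apply: sub_count => x; apply: ltnW.
- by rewrite /c count_gt_head // head_le_weight.
have <- : d' = d.
  apply: (@polyX_mul_inj R' (('X - 1) ^+ e * R)) => //.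
    rewrite hornerM mulf_neq0 // horner_exp expf_neq0 //.
    by rewrite hornerD hornerX hornerN hornerC add0r oppr_eq0 oner_eq0.
  rewrite mulrA -PE; apply: eq_poly_on_finFields => F.
  by rewrite -countP -R'E jordan_countE.
have c0 : c 0%N = size lam.
  by apply/eqP; rewrite -all_count; case/andP: lam_part.
rewrite /deficit c0 in d'E.
have sumE : (\sum_(0 <= j < (size (dual_part lam)).-1)
    (nth 0%N (dual_part lam) j * nth 0%N (dual_part lam) j.+1)%N%:Z =
    (\sum_(k < weight lam) c k * c k.+1)%N%:Z :> int).
  have le : ((head 0 lam).-1 <= weight lam)%N.
    exact: leq_trans (leq_pred _) (head_le_weight _).
  rewrite size_map size_iota -[RHS]natz natr_sum -(big_mkord xpredT (fun k => (c k * c k.+1)%:R)).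
  rewrite (big_cat_nat (leq0n _) le) /= [X in _ = _ + X]big_nat_cond [X in _ = _ + X]big1.
    by rewrite addr0; apply: eq_bigr => k _; rewrite !nth_dual_part // natz.
  by move=> k /andP[/andP[lek _] _]; rewrite [c k.+1]count_gt_head ?muln0 //; lia.
rewrite sumE -[in RHS]d'E; lia.
Qed.
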